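(* Let $C\ge 2$ and let $D$ be an even positive integer. Let $\mu_1,\dots,\mu_C\in\mathbb{R}^D$ be unit vectors with $\mu_j^\top\mu_{j'}=-\frac{1}{C-1}$ for all $j\neq j'$ (a unit-norm simplex ETF). Let $\alpha\in[0,\pi/2]$, let $A\in\mathbb{R}^{D\times D}$ satisfy $A^\top=-A$ and $A^2=-I$, set $R=\cos\alpha\,I+\sin\alpha\,A$ and classifier weights $w_j=R\mu_j$ (so that $\mu_j^\top w_j=\cos\alpha$ and the $w_j$ also form a unit-norm simplex ETF), with zero biases. For a class $c$ and noise level $\sigma>0$, let $h=\mu_c+z$ with $z\sim\mathcal{N}(0,\sigma^2 I_D)$, let $\hat\gamma(h)=\arg\max_{j}\langle w_j,h\rangle$, and for $c'\neq c$ let $$\beta_{c,c'}=\lim_{\sigma\to 0}\bigl(-\sigma^2\log P_\sigma\{\hat\gamma(h)=c'\mid \gamma=c\}\bigr).$$ Then for every class $c$, $$\min_{c'\neq c}\beta_{c,c'}\;\le\;\frac14\cos^2\alpha\,\frac{C}{C-1}\;=\;\cos^2\alpha\;\beta^*,\qquad\text{where }\beta^*=\frac{C}{4(C-1)}.$$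
   Context: Here $\gamma$ denotes the true class label of the observation $h$, and $P_\sigma$ is the probability over the Gaussian noise $z$ at noise level $\sigma$. The quantity $\beta^*=\frac{C}{C-1}\cdot\frac14$ is the optimal (large-deviations) error exponent attained when class means and classifier weights are perfectly aligned unit-norm simplex ETFs with zero bias. *)

(* Defs.v *)
From HB Require Import structures.
From mathcomp Require Import all_boot all_order all_algebra.
From mathcomp Require Import all_classical all_reals all_analysis.
Set Implicit Arguments. Unset Strict Implicit. Unset Printing Implicit Defensive.
Import Order.TTheory GRing.Theory Num.Theory.
Local Open Scope classical_set_scope.
Local Open Scope ring_scope.

Definition dotv {R : realType} {D : nat} (u v : 'cV[R]_D) : R :=
  \sum_(k < D) u k 0 * v k 0.

(* Iterated integral against n independent N(0, s^2) coordinates: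
   coordinates n-1, n-2, ..., 0 of the vector (nat -> R) are integrated
   successively against normal_prob 0 s (Tonelli-style product measure). *)
Fixpoint iter_gauss {R : realType} (s : R) (n : nat)
    (f : (nat -> R) -> \bar R) : \bar R :=
  match n with
  | 0 => f (fun _ => 0)
  | n'.+1 => (\int[normal_prob 0 s]_x
                iter_gauss s n' (fun v => f (fun i => if i == n' then x else v i)))%E
  end.

Definition gauss_prob {R : realType} (D : nat) (s : R) (E : set 'cV[R]_D) : R :=
  fine (iter_gauss s D (fun v => (\1_E (\col_(i < D) v i) : R)%:E)).

(* The argmax classifier \hat\gamma(h) = argmax_j <w_j, h> equals c'
   (unique maximiser; ties form a null set). *)
Definition predicts {R : realType} {C D : nat} (w : 'I_C -> 'cV[R]_D)
    (c' : 'I_C) (h : 'cV[R]_D) : Prop :=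
  forall j : 'I_C, j != c' -> dotv (w j) h < dotv (w c') h.

Definition misclass_prob {R : realType} {C D : nat} (mu w : 'I_C -> 'cV[R]_D)
    (c c' : 'I_C) (s : R) : R :=
  gauss_prob s [set z | predicts w c' (mu c + z)].

(* Main.v *)
(** As the noise level tends to 0, the Gaussian measure of a region decays with
    rate |v|^2/2, where v is the point of the region nearest to the origin: a
    Chernoff bound with exponential tilt v gives the lower bound on the rate,
    small boxes around points approaching v give the upper bound.  Take for c'
    the wrong class with the highest score at mu_c.  All pairwise differences
    w_c - w_j have the same squared norm 2 C/(C-1), so the error nearest to mu_c
    lies on the bisector of w_c and w_c' (or is mu_c itself if mu_c is already
    misclassified), and the other classes do not interfere there.  Since the
    scores <w_j, mu_c> sum to zero and <w_c, mu_c> = cos alpha, the best wrong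
    score is at least - cos alpha / (C-1), which bounds the rate. *)
Require Import Defs.
From HB Require Import structures.
From mathcomp Require Import all_boot all_order all_algebra.
From mathcomp Require Import all_classical all_reals all_analysis.
From mathcomp Require Import ring lra measurable_realfun.
Import Order.TTheory GRing.Theory Num.Theory numFieldNormedType.Exports.
Local Open Scope classical_set_scope.
Local Open Scope ring_scope.

(** * Integrals against a one-dimensional Gaussian *)

(* Measurability is not needed: the integral of a nonnegative function is a
   supremum over the simple functions below it. *)
Lemma ge0_le_integralT (d : measure_display) (T : measurableType d)
    (R : realType) (mu : {measure set T -> \bar R}) (f g : T -> \bar R) :
  (forall x, 0 <= f x)%E -> (forall x, f x <= g x)%E ->
  (\int[mu]_x f x <= \int[mu]_x g x)%E.
Proof.
move=> f0 fg; have g0 x : (0 <= g x)%E := le_trans (f0 x) (fg x).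
rewrite !ge0_integralTE//; apply: le_ereal_sup => _ [h /= hf <-].
by exists h => // x; exact: le_trans (hf x) (fg x).
Qed.

(** The explicit density agrees almost everywhere with the Radon-Nikodym derivative, since both
    integrate to [normal_prob] over every measurable set. *)
Lemma ge0_integral_normal_prob {R : realType} (m s : R) (f : measurableTypeR R -> \bar R) :
  measurable_fun setT f -> (forall x, 0 <= f x)%E ->
  (\int[normal_prob m s]_x f x =
   \int[lebesgue_measure]_x (f x * (normal_pdf m s x)%:E))%E.
Proof.
move=> mf f0; have dom := @normal_prob_dominates R m s.
rewrite -(Radon_Nikodym_SigmaFinite.change_of_variables dom)//.
have mpdf : measurable_fun [set: R] (fun x => (normal_pdf m s x)%:E).
  by apply/measurable_EFinP; exact: measurable_normal_pdf.
have inth := Radon_Nikodym_SigmaFinite.f_integrable dom.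
apply: ae_eq_integral => //.
- by apply: emeasurable_funM => //; exact: measurable_int inth.
- exact: emeasurable_funM.
- apply: ae_eqe_mul2l; apply: integral_ae_eq => // E _ mE.
  by rewrite -Radon_Nikodym_SigmaFinite.f_integral.
Qed.

(** Completing the square: tilting the centred density by [expR (t * x)] shifts its mean to
    [t * s ^+ 2], up to the stated constant. *)
Lemma normal_prob_mgf {R : realType} (s t : R) : s != 0 ->
  (\int[normal_prob 0 s]_x (expR (t * x))%:E =
   (expR (t ^+ 2 * s ^+ 2 / 2))%:E)%E.
Proof.
move=> s0; have mexp : measurable_fun [set: R] (fun x => expR (t * x)).
  by apply: measurableT_comp => //; exact: measurable_funM.
rewrite ge0_integral_normal_prob; first last.
- by move=> x; rewrite lee_fin expR_ge0.
- exact/measurable_EFinP.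
transitivity (\int[lebesgue_measure]_x ((expR (t ^+ 2 * s ^+ 2 / 2))%:E *
    (normal_pdf (t * s ^+ 2) s x)%:E))%E.
  apply: eq_integral => x _; rewrite -!EFinM !normal_pdfE//; congr EFin.
  rewrite /normal_fun mulrCA [RHS]mulrCA; congr (_ * _).
  by rewrite -!expRD; congr expR; field.
rewrite ge0_integralZl//.
- by rewrite integral_normal_pdf mule1.
- by apply/measurable_EFinP; exact: measurable_normal_pdf.
- by move=> x _; rewrite lee_fin normal_pdf_ge0.
Qed.

(** On the interval the density is at least its value at distance [|a| + eta] from 0. The last
    hypothesis says that the length [2 * eta] times the peak of the density is at least 1, so no
    prefactor remains. *)
Lemma normal_prob_itv_ge {R : realType} (s a eta : R) :
  0 < eta -> 0 < s -> s ^+ 2 * pi *+ 2 <= (2 * eta) ^+ 2 ->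
  ((expR (- (`|a| + eta) ^+ 2 / (s ^+ 2 *+ 2)))%R%:E <=
   normal_prob 0 s `[(a - eta)%R, (a + eta)%R])%E.
Proof.
move=> eta0 s0 hs; have sn0 : s != 0 by rewrite gt_eqF.
rewrite /normal_prob.
pose c := normal_peak s * expR (- (`|a| + eta) ^+ 2 / (s ^+ 2 *+ 2)).
apply: (@le_trans _ _ (\int[lebesgue_measure]_(x in `[(a - eta)%R, (a + eta)%R]) c%:E)%E).
  rewrite integral_cst//= lebesgue_measure_itv/= lte_fin ifT; last by lra.
  rewrite -EFinB -EFinM lee_fin mulrAC ler_peMl ?expR_ge0//.
  rewrite (_ : a + eta - (a - eta) = 2 * eta); last by ring.
  rewrite /normal_peak mulrC ler_pdivlMr ?mul1r; last first.
    by rewrite sqrtr_gt0 mulrn_wgt0// mulr_gt0 ?pi_gt0// exprn_gt0.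
  rewrite -[leRHS]ger0_norm; last by lra.
  by rewrite -sqrtr_sqr; exact: ler_wsqrtr.
apply: ge0_le_integral => //=.
- by move=> x _; rewrite lee_fin mulr_ge0 ?normal_peak_ge0 ?expR_ge0.
- by apply/measurable_EFinP; apply: measurable_funTS; exact: measurable_normal_pdf.
- move=> x; rewrite in_itv/= => /andP[x1 x2].
  rewrite lee_fin normal_pdfE// ler_pM2l ?normal_peak_gt0// ler_expR.
  rewrite subr0 ler_wpM2r ?invr_ge0 ?mulrn_wge0 ?sqr_ge0// lerN2.
  have h : `|x| <= `|a| + eta.
    rewrite -[x in `|x|](subrKC a) (le_trans (ler_normD _ _))// lerD2l.
    by rewrite ler_distl x1.
  rewrite -real_normK ?num_real// lerXn2r// nnegrE//.
  exact: le_trans (normr_ge0 x) h.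
Qed.

(** * Iterated Gaussian integrals *)

Lemma iter_gauss_ge0 {R : realType} (s : R) (n : nat) (f : (nat -> R) -> \bar R) :
  (forall v, 0 <= f v)%E -> (0 <= iter_gauss s n f)%E.
Proof. by elim: n f => [|n IH] f f0 //=; apply: integral_ge0 => x _; exact: IH. Qed.

Lemma ge0_le_iter_gauss {R : realType} (s : R) (n : nat)
    (f g : (nat -> R) -> \bar R) :
  (forall v, 0 <= f v)%E -> (forall v, f v <= g v)%E ->
  (iter_gauss s n f <= iter_gauss s n g)%E.
Proof.
elim: n f g => [|n IH] f g f0 fg //=.
apply: ge0_le_integralT => x; first exact: iter_gauss_ge0.
exact: IH.
Qed.

(** The constant [k] serves the induction: once the outermost variable is fixed, its factor is
    absorbed into [k]. *)
Lemma iter_gauss_prod {R : realType} (s : R) (n : nat) (g : 'I_n -> R -> R)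
    (m : 'I_n -> R) (k : R) :
  0 <= k -> (forall i, measurable_fun [set: R] (g i)) -> (forall i x, 0 <= g i x) ->
  (forall i, \int[normal_prob 0 s]_x (g i x)%:E = (m i)%:E)%E ->
  iter_gauss s n (fun v => (k * \prod_(i < n) g i (v i))%:E) =
  (k * \prod_(i < n) m i)%:E.
Proof.
elim: n g m k => [|n IH] g m k k0 mg g0 hm /=; first by rewrite !big_ord0.
transitivity (\int[normal_prob 0 s]_x ((k * \prod_(i < n)
    m (widen_ord (leqnSn n) i))%:E * (g ord_max x)%:E))%E.
  apply: eq_integral => x _.
  rewrite -EFinM mulrAC -(IH (fun i => g (widen_ord (leqnSn n) i)))//; last first.
    by rewrite mulr_ge0.
  congr iter_gauss; apply/funext => v; rewrite big_ord_recr/= eqxx.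
  under eq_bigr => i _ do rewrite ltn_eqF//.
  by congr EFin; ring.
rewrite ge0_integralZl//.
- by rewrite hm -EFinM big_ord_recr/= mulrA.
- by apply/measurable_EFinP; exact: mg.
- by move=> x _; rewrite lee_fin.
- have m0 i : 0 <= m i.
    by rewrite -lee_fin -hm; apply: integral_ge0 => x _; rewrite lee_fin.
  by rewrite lee_fin mulr_ge0// prodr_ge0.
Qed.

(** * Exponential bounds and the small-noise rate *)

(** Chernoff bound: on [E] the indicator is at most the exponential of
    [(dotv v z - dotv v v) / s ^+ 2], whose integral factors into moment generating functions. *)
Lemma iter_gauss_indic_le {R : realType} (D : nat) (s : R) (E : set 'cV[R]_D)
    (v : 'cV[R]_D) :
  0 < s -> (forall z, E z -> dotv v v <= dotv v z) ->
  (iter_gauss s D (fun x => (\1_E (\col_(i < D) x i) : R)%:E) <=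
   (expR (- dotv v v / (s ^+ 2 *+ 2)))%:E)%E.
Proof.
move=> s0 hE; have sn0 : s != 0 by rewrite gt_eqF.
pose g (i : 'I_D) x := expR (v i 0 / s ^+ 2 * x).
pose m (i : 'I_D) := expR ((v i 0 / s ^+ 2) ^+ 2 * s ^+ 2 / 2).
(* The first term is the normalisation of the tilt, the sum collects the exponents of the
   one-dimensional generating functions. *)
have -> : - dotv v v / (s ^+ 2 *+ 2) =
    - dotv v v / s ^+ 2 + \sum_i (v i 0 / s ^+ 2) ^+ 2 * s ^+ 2 / 2.
  rewrite [X in _ = _ + X](_ : _ = (s ^+ 2 *+ 2)^-1 * dotv v v); last first.
    by rewrite mulr_sumr; apply: eq_bigr => i _; field.
  by field.
rewrite expRD expR_sum -(@iter_gauss_prod _ s D g m)//; first last.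
- by move=> i; exact: normal_prob_mgf.
- by move=> i x; exact: expR_ge0.
- by move=> i; apply: measurableT_comp => //; exact: measurable_funM.
apply: ge0_le_iter_gauss => x; first by rewrite lee_fin.
rewrite lee_fin indicE; case: (boolP (_ \in E)) => [|_]; last first.
  by rewrite mulr_ge0 ?expR_ge0// prodr_ge0// => i _; exact: expR_ge0.
rewrite inE => /hE hz; rewrite /g -expR_sum -expRD -[leLHS]expR0 ler_expR.
have -> : \sum_(i < D) v i 0 / s ^+ 2 * x i =
    dotv v (\col_(i < D) x i) / s ^+ 2.
  by rewrite mulr_suml; apply: eq_bigr => i _; rewrite mxE; ring.
by rewrite -mulrDl mulr_ge0 ?invr_ge0 ?sqr_ge0// addrC subr_ge0.
Qed.

(** The tilt by 0 bounds the integral by 1, so [fine] in [gauss_prob] keeps its value. *)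
Lemma iter_gauss_indic_fin_num {R : realType} (D : nat) (s : R) (E : set 'cV[R]_D) :
  0 < s -> iter_gauss s D (fun x => (\1_E (\col_(i < D) x i) : R)%:E) \is a fin_num.
Proof.
move=> s0; rewrite ge0_fin_numE; last first.
  by apply: iter_gauss_ge0 => x; rewrite lee_fin.
apply: le_lt_trans (iter_gauss_indic_le D s E 0 s0 _) (ltry _) => z _.
by rewrite /dotv !big1// => i _; rewrite mxE mul0r.
Qed.

Lemma gauss_prob_le {R : realType} (D : nat) (s : R) (E : set 'cV[R]_D)
    (v : 'cV[R]_D) :
  0 < s -> (forall z, E z -> dotv v v <= dotv v z) ->
  gauss_prob s E <= expR (- dotv v v / (s ^+ 2 *+ 2)).
Proof.
move=> s0 hE; rewrite -lee_fin fineK ?iter_gauss_indic_fin_num//.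
exact: iter_gauss_indic_le.
Qed.

(** [E] contains a box around [a], whose measure is a product of interval probabilities. *)
Lemma gauss_prob_ge {R : realType} (D : nat) (s eta : R) (E : set 'cV[R]_D)
    (a : 'cV[R]_D) :
  0 < s -> 0 < eta -> s ^+ 2 * pi *+ 2 <= (2 * eta) ^+ 2 ->
  (forall z : 'cV[R]_D, (forall i, `|z i 0 - a i 0| <= eta) -> E z) ->
  expR (- (\sum_i (`|a i 0| + eta) ^+ 2) / (s ^+ 2 *+ 2)) <= gauss_prob s E.
Proof.
move=> s0 eta0 hs hE.
rewrite -lee_fin fineK ?iter_gauss_indic_fin_num//.
pose I (i : 'I_D) : set R := `[a i 0 - eta, a i 0 + eta]%classic.
pose m (i : 'I_D) := fine (normal_prob 0 s (I i)).
have mE i : (m i)%:E = normal_prob 0 s (I i).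
  by rewrite fineK//; apply: fin_num_measure; exact: measurable_itv.
apply: (@le_trans _ _ (1 * \prod_i m i)%:E).
  rewrite mul1r lee_fin -sumrN mulr_suml expR_sum.
  apply: ler_prod => i _; rewrite expR_ge0 -lee_fin mE.
  exact: normal_prob_itv_ge.
rewrite -(@iter_gauss_prod _ s D (fun i => \1_(I i)))//.
- apply: ge0_le_iter_gauss => x.
    by rewrite lee_fin mul1r prodr_ge0.
  rewrite lee_fin mul1r [leRHS]indicE; case: (boolP (_ \in E)) => [_|].
    by apply: prodr_ile1 => i _; rewrite indicE; case: (_ \in _); rewrite ?lexx ?ler01.
  apply: contraNT; rewrite -ltNge => h.
  rewrite inE; apply: hE => i; rewrite mxE.
  have : \1_(I i) (x i) != 0 :> R.
    by apply: contraTneq h => xi0; rewrite (bigD1 i)//= xi0 mul0r ltxx.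
  rewrite indicE pnatr_eq0 eqb0 negbK inE /I /= in_itv/=.
  by rewrite ler_distl.
- by move=> i; apply: measurable_indic; exact: measurable_itv.
- by move=> i; rewrite mE integral_indic ?setIT//; exact: measurable_itv.
Qed.

(* The two hypotheses make [v] the point of the closure of [E] nearest to 0, and
   a limit of interior points. *)
Lemma gauss_prob_rate {R : realType} (D : nat) (E : set 'cV[R]_D) (v : 'cV[R]_D) :
  (forall z, E z -> dotv v v <= dotv v z) ->
  (forall e : R, 0 < e -> exists a : 'cV[R]_D, exists2 eta : R, 0 < eta &
     (forall i, `|a i 0 - v i 0| <= e) /\
     (forall z : 'cV[R]_D, (forall i, `|z i 0 - a i 0| <= eta) -> E z)) ->
  (fun s : R => - s ^+ 2 * ln (gauss_prob s E) : R) @ (0:R)^'+ --> dotv v v / 2.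
Proof.
move=> hE hbox; apply/cvgrPdist_le => /= eps eps0.
pose S := \sum_i `|v i 0|; have S0 : 0 <= S by exact: sumr_ge0.
(* For [e <= 1], enlarging every [|v i 0|] by [2 * e] raises the sum of squares by at most
   [2 * e * K]. The target is [2 * eps], as the exponent is divided by [s ^+ 2 *+ 2]. *)
pose K := 2 * S + 2 * D%:R; have K0 : 0 <= K by rewrite addr_ge0 ?mulr_ge0.
pose e := Num.min 1 (eps / (K + 1)).
have e0 : 0 < e by rewrite lt_min ltr01 divr_gt0//; lra.
have e1 : e <= 1 by rewrite ge_min lexx.
have eK : e * K <= eps.
  have : e <= eps / (K + 1) by rewrite ge_min lexx orbT.
  by rewrite ler_pdivlMr; nra.
have [a [eta eta0 [av hB]]] := hbox e e0.
(* A box of half-width [h] stays inside [E] and costs at most another [e] per coordinate. *)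
pose h := Num.min eta e.
have h0 : 0 < h by rewrite lt_min eta0.
have heta : h <= eta by rewrite ge_min lexx.
have he : h <= e by rewrite ge_min lexx orbT.
have hS : \sum_i (`|a i 0| + h) ^+ 2 <= dotv v v + 2 * eps.
  apply: (@le_trans _ _ (\sum_i (v i 0 * v i 0 + (4 * e * `|v i 0| + 4 * e)))).
    apply: ler_sum => i _; have avi := av i.
    have ai : `|a i 0| <= `|v i 0| + e.
      by rewrite -[a i 0](subrKC (v i 0)) (le_trans (ler_normD _ _))// lerD2l.
    apply: (@le_trans _ _ ((`|v i 0| + 2 * e) ^+ 2)).
      by apply: lerXn2r; rewrite ?nnegrE ?addr_ge0 ?mulr_ge0 ?(ltW h0) ?(ltW e0)//; lra.
    rewrite sqrrD real_normK ?num_real//; have e2 : e ^+ 2 <= e by rewrite expr2 ler_piMr// ltW.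
    nra.
  rewrite !big_split/= lerD2l -mulr_sumr -/S sumr_const card_ord -mulr_natr.
  by move: eK; rewrite /K; nra.
near=> s.
have s0 : 0 < s by near: s; exact: nbhs_right_gt.
have sh : s <= h / 2 by near: s; apply: nbhs_right_le; rewrite divr_gt0.
have lo := gauss_prob_le D s E v s0 hE.
have up : expR (- (\sum_i (`|a i 0| + h) ^+ 2) / (s ^+ 2 *+ 2)) <= gauss_prob s E.
  apply: gauss_prob_ge => //.
  (* From [s <= h / 2] and [pi < 4], the left side is at most [2 * h ^+ 2]. *)
  - have := @pihalf_lt2 R; have := @pi_gt0 R; rewrite -mulr_natr; nra.
  - by move=> z hz; apply: hB => i; exact: le_trans (hz i) heta.
(* Positivity makes [ln] a true logarithm here, inverse to [expR]. *)
have P0 := lt_le_trans (expR_gt0 _) up.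
move: lo up; rewrite -[X in X <= expR _]lnK ?posrE// ler_expR => lo.
rewrite -[X in _ <= X]lnK ?posrE// ler_expR => up.
have s20 : 0 < s ^+ 2 *+ 2 by rewrite mulrn_wgt0// exprn_gt0.
move: lo up; rewrite ler_pdivlMr// ler_pdivrMr// -mulr_natr.
set L := ln _ => lo up.
by rewrite ler_norml; apply/andP; split; nra.
Unshelve. all: by end_near. Qed.

(** * Inner product algebra *)

Lemma dotvE {R : realType} (D : nat) (u v : 'cV[R]_D) : dotv u v = (u^T *m v) 0 0.
Proof. by rewrite mxE; apply: eq_bigr => i _; rewrite mxE. Qed.

Lemma dotvC {R : realType} (D : nat) (u v : 'cV[R]_D) : dotv u v = dotv v u.
Proof. by apply: eq_bigr => i _; rewrite mulrC. Qed.

Lemma dotvDr {R : realType} (D : nat) (u v w : 'cV[R]_D) :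
  dotv u (v + w) = dotv u v + dotv u w.
Proof. by rewrite !dotvE mulmxDr mxE. Qed.

Lemma dotvNr {R : realType} (D : nat) (u v : 'cV[R]_D) : dotv u (- v) = - dotv u v.
Proof. by rewrite !dotvE mulmxN mxE. Qed.

Lemma dotvZr {R : realType} (D : nat) (k : R) (u v : 'cV[R]_D) :
  dotv u (k *: v) = k * dotv u v.
Proof. by rewrite !dotvE -scalemxAr mxE. Qed.

Lemma dotvDl {R : realType} (D : nat) (u v w : 'cV[R]_D) :
  dotv (u + v) w = dotv u w + dotv v w.
Proof. by rewrite !(dotvC _ _ w) dotvDr. Qed.

Lemma dotvNl {R : realType} (D : nat) (u v : 'cV[R]_D) : dotv (- u) v = - dotv u v.
Proof. by rewrite !(dotvC _ _ v) dotvNr. Qed.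

Lemma dotvZl {R : realType} (D : nat) (k : R) (u v : 'cV[R]_D) :
  dotv (k *: u) v = k * dotv u v.
Proof. by rewrite !(dotvC _ _ v) dotvZr. Qed.

Lemma dotv_suml {R : realType} (D : nat) (I : finType) (P : pred I)
    (F : I -> 'cV[R]_D) (v : 'cV[R]_D) :
  dotv (\sum_(i | P i) F i) v = \sum_(i | P i) dotv (F i) v.
Proof.
rewrite dotvE linear_sum mulmx_suml summxE.
by apply: eq_bigr => i _; rewrite dotvE.
Qed.

Lemma dotv_mulmxl {R : realType} (D : nat) (A : 'M[R]_D) (u v : 'cV[R]_D) :
  dotv (A *m u) v = dotv u (A^T *m v).
Proof. by rewrite !dotvE trmx_mul mulmxA. Qed.

Lemma dotv_eq0 {R : realType} (D : nat) (u : 'cV[R]_D) : dotv u u = 0 -> u = 0.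
Proof.
move=> u0; apply/colP => i; rewrite mxE; apply/eqP.
rewrite -[_ == 0]orbb -mulf_eq0.
by move/psumr_eq0P : u0 => -> // j _; rewrite -expr2 sqr_ge0.
Qed.

Lemma norm_coord_unit {R : realType} (D : nat) (u : 'cV[R]_D) (i : 'I_D) :
  dotv u u = 1 -> `|u i 0| <= 1.
Proof.
move=> u1; rewrite -(@ler_pXn2r _ 2)// ?nnegrE// expr1n real_normK ?num_real//.
rewrite -u1 /dotv (bigD1 i)//= expr2 lerDl sumr_ge0// => j _.
by rewrite -expr2 sqr_ge0.
Qed.

Lemma norm_dotv_le {R : realType} (D : nat) (u r : 'cV[R]_D) (eta : R) :
  dotv u u = 1 -> (forall i, `|r i 0| <= eta) -> `|dotv u r| <= D%:R * eta.
Proof.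
move=> u1 hr; rewrite (le_trans (ler_norm_sum _ _ _))//.
rewrite mulr_natl -[D in leRHS]card_ord -sumr_const ler_sum// => i _.
rewrite normrM -[leRHS]mul1r ler_pM//; exact: norm_coord_unit.
Qed.

(** * Skew rotations and simplex ETFs *)

Lemma dotv_skew {R : realType} (D : nat) (A : 'M[R]_D) (u v : 'cV[R]_D) :
  A^T = - A -> dotv (A *m u) v = - dotv u (A *m v).
Proof. by move=> hA; rewrite dotv_mulmxl hA mulNmx dotvNr. Qed.

(** Skewness cancels the cross terms, and with [A *m A = - 1%:M] it makes [A] an isometry; what
    remains is the sum of the squares of cosine and sine. *)
Lemma dotv_rot {R : realType} (D : nat) (A : 'M[R]_D) (alpha : R)
    (Rot := cos alpha *: 1%:M + sin alpha *: A) (u v : 'cV[R]_D) :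
  A^T = - A -> A *m A = - 1%:M -> dotv (Rot *m u) (Rot *m v) = dotv u v.
Proof.
move=> hA hA2; rewrite /Rot !mulmxDl -!scalemxAl !mul1mx.
rewrite !(dotvDl, dotvDr, dotvZl, dotvZr) !dotv_skew// mulmxA hA2 mulNmx mul1mx.
rewrite dotvNr -[RHS]mul1r -(cos2Dsin2 alpha); ring.
Qed.

Lemma dotv_rot_self {R : realType} (D : nat) (A : 'M[R]_D) (alpha : R)
    (Rot := cos alpha *: 1%:M + sin alpha *: A) (u : 'cV[R]_D) :
  A^T = - A -> dotv (Rot *m u) u = cos alpha * dotv u u.
Proof.
move=> hA; rewrite /Rot !mulmxDl -!scalemxAl mul1mx dotvDl !dotvZl.
suff -> : dotv (A *m u) u = 0 by rewrite mulr0 addr0.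
by have := dotv_skew D A u u hA; rewrite [dotv u (A *m u)]dotvC; lra.
Qed.

(** Each [w i] is orthogonal to the sum, as [1 - (C - 1) / (C - 1) = 0]; hence the sum has norm
    0. *)
Lemma etf_sum0 {R : realType} (C D : nat) (w : 'I_C -> 'cV[R]_D) :
  (2 <= C)%N -> (forall j, dotv (w j) (w j) = 1) ->
  (forall j j', j != j' -> dotv (w j) (w j') = - (C%:R - 1)^-1) ->
  \sum_j w j = 0.
Proof.
move=> hC w1 wE; apply: dotv_eq0; rewrite dotv_suml big1// => i _.
rewrite dotvC dotv_suml (bigD1 i)//= w1.
under eq_bigr => j ji do rewrite wE//.
rewrite sumr_const cardC1 card_ord -[_ *+ _]mulr_natl -subn1 natrB ?(ltnW hC)//.
have C1 : (1 : R) < C%:R by rewrite ltr1n.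
by field; lra.
Qed.

(** * The misclassification rate and its bound *)

(** Here [2 * k] is the squared distance between two weights, so the bisector lies at squared
    distance [gap ^+ 2 / (2 * k)] and the rate is half of that. The maximum with 0 covers an [x] at
    which [c] does not win. *)
Lemma etf_classifier_rate {R : realType} (C D : nat) (w : 'I_C -> 'cV[R]_D)
    (x : 'cV[R]_D) (c c' : 'I_C) (k := C%:R / (C%:R - 1) : R) :
  (2 <= C)%N -> (forall j, dotv (w j) (w j) = 1) ->
  (forall j j', j != j' -> dotv (w j) (w j') = - (C%:R - 1)^-1) ->
  c' != c -> (forall j, j != c -> dotv (w j) x <= dotv (w c') x) ->
  (fun s : R => - s ^+ 2 * ln (gauss_prob s [set z | predicts w c' (x + z)]) : R)
    @ (0:R)^'+ --> Num.max 0 (dotv (w c) x - dotv (w c') x) ^+ 2 / (4 * k).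
Proof.
move=> hC w1 wE cc' hmax.
set d := dotv (w c) x - dotv (w c') x; set gap := Num.max 0 d.
have C1 : (1 : R) < C%:R by rewrite ltr1n.
have kE : k = 1 + (C%:R - 1)^-1 by rewrite /k; field; lra.
have k1 : 1 <= k by rewrite kE lerDl invr_ge0; lra.
have gap0 : 0 <= gap by rewrite le_max lexx.
have gapd : d <= gap by rewrite le_max lexx orbT.
(* [v] below is the shift that moves [x] to the bisector of [w c] and [w c'];
   moving on along [w c'] makes [c'] the strict winner. *)
pose t := gap / (2 * k).
have t0 : 0 <= t by rewrite divr_ge0//; lra.
have tk : t * (2 * k) = gap by rewrite divfK//; lra.
(* [gap] is 0 or [d]; this identity treats both cases at once. *)
have gd : gap * gap = gap * d.
  by rewrite /gap /Num.max; case: ifP => _; rewrite ?mul0r.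
pose v := t *: (w c' - w c).
have wk i j : i != j -> 1 - dotv (w i) (w j) = k by move=> ij; rewrite wE// kE opprK.
have wcc : dotv (w c' - w c) (w c' - w c) = 2 * k.
  rewrite !(dotvDl, dotvDr, dotvNl, dotvNr) !w1 [dotv (w c) _]dotvC.
  have := wk _ _ cc'; lra.
have vv : dotv v v = t * gap by rewrite dotvZl dotvZr wcc tk.
rewrite (_ : _ / (4 * k) = dotv v v / 2); last by rewrite vv /t; field; lra.
apply: gauss_prob_rate => [z hz|e e0].
  (* Beating class [c] gives [dotv (w c' - w c) z > d], which is then scaled by [t]. *)
  have {hz} := hz c; rewrite eq_sym => /(_ cc'); rewrite !dotvDr => hz.
  rewrite vv dotvZl dotvDl dotvNl.
  have : t * gap = t * d by rewrite /t mulrAC gd mulrAC.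
  move=> ->; rewrite ler_wpM2l// /d; lra.
have D1 : 0 < 2 * D%:R + 1 :> R by have := ler0n R D; lra.
(* The shift along [w c'] gains a margin [e * k >= e] over every other class. Inside the box each
   score moves by at most [D * eta], so a difference of two moves by at most [2 * D * eta < e]. *)
exists (v + e *: w c'); exists (e / (2 * D%:R + 1)); first exact: divr_gt0.
split=> [i|z hz j jc'].
  rewrite !mxE [X in `|X|](_ : _ = e * w c' i 0); last by ring.
  rewrite normrM (gtr0_norm e0) ler_piMr ?(ltW e0)//; exact: norm_coord_unit.
set eta := e / _ in hz.
have heta : 2 * D%:R * eta < e.
  rewrite /eta mulrA ltr_pdivrMr//.
  by rewrite mulrC ltr_pM2l// ltrDl.
pose r := z - (v + e *: w c').
have hr i : `|r i 0| <= eta by have := hz i; rewrite !mxE.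
have zE : z = v + e *: w c' + r by rewrite /r addrC subrK.
clearbody r.
have r1 := norm_dotv_le D (w c') r eta (w1 _) hr.
have r2 := norm_dotv_le D (w j) r eta (w1 _) hr.
move: r1 r2; rewrite !ler_norml => /andP[r1 _] /andP[_ r2].
have ek : e <= e * k by rewrite ler_peMr// ltW.
rewrite zE /v !(dotvDr, dotvZr, dotvNr) w1.
have dot_k i i' : i != i' -> dotv (w i) (w i') = 1 - k by move/wk => <-; ring.
rewrite (dot_k _ _ jc') (dot_k _ _ cc').
have [jc|jc] := eqVneq j c.
  by rewrite jc w1 in r2 *; move: gapd; rewrite /d -tk; nra.
(* For a third class, [v] adds [t * k >= 0] to the lead of [c'], which was already nonnegative at
   [x]. *)
rewrite (dot_k _ _ jc); have := hmax _ jc.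
have := mulr_ge0 t0 (le_trans ler01 k1); nra.
Qed.

Theorem theorem5 (R : realType) (C D : nat) (hC : (2 <= C)%N)
    (hD0 : (0 < D)%N) (hDeven : ~~ odd D)
    (mu : 'I_C -> 'cV[R]_D)
    (hmu_unit : forall j, dotv (mu j) (mu j) = 1)
    (hmu_etf : forall j j', j != j' -> dotv (mu j) (mu j') = - (C%:R - 1)^-1)
    (alpha : R) (halpha : 0 <= alpha <= pi / 2)
    (A : 'M[R]_D) (hA_skew : A^T = - A) (hA_sq : A *m A = - 1%:M)
    (c : 'I_C) :
  let Rot := cos alpha *: 1%:M + sin alpha *: A in
  let w := fun j => Rot *m mu j in
  exists2 c' : 'I_C, c' != c &
    exists2 b : R,
      (fun s : R => - s ^+ 2 * ln (misclass_prob mu w c c' s) : R) @ (0:R)^'+ --> b &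
      b <= 4^-1 * cos alpha ^+ 2 * (C%:R / (C%:R - 1)).
Proof.
move=> Rot w.
have w1 j : dotv (w j) (w j) = 1 by rewrite dotv_rot.
have wE j j' : j != j' -> dotv (w j) (w j') = - (C%:R - 1)^-1.
  by move=> jj'; rewrite dotv_rot// hmu_etf.
have wc : dotv (w c) (mu c) = cos alpha by rewrite dotv_rot_self// hmu_unit mulr1.
have cos0 : 0 <= cos alpha.
  by apply: cos_ge0_pihalf; case/andP: halpha => ? ?; apply/andP; split; have := @pi_ge0 R; lra.
have [j0 j0c] : exists j, j != c.
  have : (0 < #|predC1 c|)%N by rewrite cardC1 card_ord -subn1 subn_gt0.
  by case/card_gt0P => j; exists j.
pose F j := dotv (w j) (mu c).
have [c' cc' hmax] := @arg_maxP _ R _ j0 (fun j => j != c) F j0c.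
exists c' => //.
exists (Num.max 0 (dotv (w c) (mu c) - dotv (w c') (mu c)) ^+ 2 /
    (4 * (C%:R / (C%:R - 1)))).
  exact: etf_classifier_rate.
have C1 : (1 : R) < C%:R by rewrite ltr1n.
(* The scores <w_j, mu_c> sum to zero, so the best wrong class scores at least
   the average [- cos alpha / (C - 1)] of the wrong classes. *)
have hsum : - cos alpha <= (C%:R - 1) * dotv (w c') (mu c).
  have := congr1 (fun u => dotv u (mu c)) (etf_sum0 C D w hC w1 wE).
  rewrite /= dotv_suml (bigD1 c)//= wc => /eqP.
  rewrite [dotv 0 _]big1; last by move=> i _; rewrite mxE mul0r.
  rewrite addr_eq0 => /eqP ->; rewrite opprK.
  have -> : (C%:R - 1) * dotv (w c') (mu c) =
      \sum_(j | j != c) dotv (w c') (mu c).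
    by rewrite sumr_const cardC1 card_ord -[RHS]mulr_natl -subn1 natrB// ltnW.
  exact: ler_sum.
set k := C%:R / (C%:R - 1).
have k0 : 0 < k by rewrite divr_gt0//; lra.
set g := Num.max _ _.
have g0 : 0 <= g by rewrite le_max lexx.
(* The term 0 of the maximum is covered by [cos alpha >= 0]; the other is at most [cos alpha + cos
   alpha / (C - 1) = cos alpha * k] by [hsum]. *)
have gk : g <= cos alpha * k.
  rewrite ge_max mulr_ge0 ?(ltW k0)//= wc /k mulrA ler_pdivlMr; last by lra.
  lra.
rewrite ler_pdivrMr; last exact: mulr_gt0.
have -> : 4^-1 * cos alpha ^+ 2 * k * (4 * k) = (cos alpha * k) ^+ 2 by field.
by rewrite lerXn2r// nnegrE mulr_ge0// ltW.
Qed.
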